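(* Let $A\in\mathbb{C}^{n\times n}$ and $S\in\mathbb{C}^{s\times n}$. Let $u\in\mathbb{C}^n$ satisfy $\|Su\|=1$, let $\theta\in\mathbb{C}$ with $\theta\notin\lambda(A)$, and assume $(Su)^*S(A-\theta I)^{-1}u\neq 0$. Put $r=Au-\theta u$ and $\Pi_u^S=I-u(Su)^*S$. Then there exists a unique $t\in\mathbb{C}^n$ with $t\perp_S u$ solving the randomized correction equation $$\Pi_u^S(A-\theta I)\Pi_u^S t=-\Pi_u^S r,$$ and it satisfies $$u+t=\alpha(A-\theta I)^{-1}u,\qquad \alpha=\bigl((Su)^*S(A-\theta I)^{-1}u\bigr)^{-1}.$$ In particular this applies to the sketched Rayleigh quotient $\theta=(Su)^*(SAu)$.
   Context: $\|\cdot\|$ is the Euclidean norm, $\lambda(A)$ is the spectrum of $A$, $^*$ is the conjugate transpose. For vectors $x,y\in\mathbb{C}^n$, $x\perp_S y$ means $\langle Sx,Sy\rangle=(Sx)^*(Sy)=0$. The matrix $S$ is a given sketching matrix. *)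

(* Defs.v *)
From HB Require Import structures.
From mathcomp Require Import all_boot all_order all_algebra.
From mathcomp Require Import reals.
From mathcomp Require Export complex.

Set Implicit Arguments.
Unset Strict Implicit.
Unset Printing Implicit Defensive.

Import Order.TTheory GRing.Theory Num.Theory.
Local Open Scope ring_scope.
Local Open Scope sesquilinear_scope.

Section SketchedGeometry.
Variable R : realType.
Local Notation C := R[i].

(* Column-vector convention, conjugate-linear in the first argument;
   [dotmx] of the library is for row vectors, conjugate-linear in the second. *)
Definition cdot m (x y : 'cV[C]_m) : C := (x ^t* *m y) 0 0.

(* [`|x|] on a matrix is not the Euclidean norm (it is the sup norm when
   MathComp-Analysis is loaded). *)
Definition enorm m (x : 'cV[C]_m) : C := sqrtC (\sum_i `|x i 0| ^+ 2).

Variables (s n : nat) (S : 'M[C]_(s, n)).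

Definition sketch_orth (x y : 'cV[C]_n) : Prop :=
  cdot (S *m x) (S *m y) = 0.

Definition sketch_proj (u : 'cV[C]_n) : 'M[C]_n :=
  1%:M - u *m (S *m u) ^t* *m S.

Definition sketch_rayleigh (A : 'M[C]_n) (u : 'cV[C]_n) : C :=
  cdot (S *m u) (S *m (A *m u)).

Definition residual (A : 'M[C]_n) (theta : C) (u : 'cV[C]_n) : 'cV[C]_n :=
  A *m u - theta *: u.

Definition correction_eq (A : 'M[C]_n) (theta : C) (u t : 'cV[C]_n) : Prop :=
  sketch_proj u *m (A - theta%:M) *m sketch_proj u *m t =
  - (sketch_proj u *m residual A theta u).

End SketchedGeometry.

(* Main.v *)
(** Write [p x = <Su, Sx>], so that [Pi x = x - p x *: u], and [B = A - theta I].
    Since [r = B u] and [Pi t = t] when [p t = 0], the correction equation says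
    that [B (u + t)] lies in [ker Pi], the line spanned by [u]; hence [u + t] is
    a multiple of [B^-1 u], and [p (u + t) = p u = 1] fixes the factor. *)

Require Import Defs.
From mathcomp Require Import all_boot all_order all_algebra.
From mathcomp Require Import reals.

Import Order.TTheory GRing.Theory Num.Theory.
Local Open Scope ring_scope.

Section CorrectionEquation.
Variable R : realType.
Local Notation C := R[i].

Lemma cdotC m (x y : 'cV[C]_m) : cdot y x = Num.conj (cdot x y).
Proof.
rewrite /cdot !mxE rmorph_sum; apply: eq_bigr => k _.
by rewrite !mxE rmorphM /= conjCK mulrC.
Qed.

Lemma cdotDr m (x y z : 'cV[C]_m) : cdot x (y + z) = cdot x y + cdot x z.
Proof. by rewrite /cdot mulmxDr mxE. Qed.

Lemma cdotZr m (x y : 'cV[C]_m) a : cdot x (a *: y) = a * cdot x y.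
Proof. by rewrite /cdot -scalemxAr mxE. Qed.

Lemma enorm_sqr m (x : 'cV[C]_m) : enorm x ^+ 2 = cdot x x.
Proof.
rewrite /enorm sqrtCK /cdot mxE; apply: eq_bigr => k _.
by rewrite !mxE normCKC.
Qed.

(** [eigenvalue] is about row vectors: the eigenspace is the left kernel of [A - a%:M]. When it is
    trivial the rows are free, and a square matrix with free rows is invertible. *)
Lemma eigenvalueN_unitmx (F : fieldType) n (A : 'M[F]_n) a :
  ~~ eigenvalue A a -> A - a%:M \in unitmx.
Proof.
by rewrite /eigenvalue negbK /eigenspace kermx_eq0 row_free_unit.
Qed.

Variables (n s : nat) (A : 'M[C]_n) (S : 'M[C]_(s, n)) (u : 'cV[C]_n).

(** Conjugate symmetry moves [t] into the linear slot, so that orthogonality reads [p t = 0]. *)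
Lemma sketch_orthE t : sketch_orth S t u <-> cdot (S *m u) (S *m t) = 0.
Proof.
rewrite /sketch_orth cdotC; split=> [/eqP|->]; last by rewrite conjC0.
by rewrite conjC_eq0 => /eqP.
Qed.

Lemma mul_sketch_proj x :
  sketch_proj S u *m x = x - cdot (S *m u) (S *m x) *: u.
Proof.
rewrite /sketch_proj mulmxBl mul1mx -!mulmxA; congr (_ - _).
(* The product of [(S *m u) ^t*] with [S *m x] is a 1x1 matrix, so multiplying [u] by it is scaling
   by its entry [p x]. *)
by rewrite [X in u *m X]mx11_scalar mul_mx_scalar.
Qed.

Lemma residualE theta : residual A theta u = (A - theta%:M) *m u.
Proof. by rewrite /residual mulmxBl mul_scalar_mx. Qed.

Lemma correction_eqE theta t : sketch_orth S t u ->
  correction_eq S A theta u t <->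
  sketch_proj S u *m ((A - theta%:M) *m (u + t)) = 0.
Proof.
move=> /sketch_orthE t_orth; rewrite /correction_eq residualE.
rewrite -(mulmxA _ (sketch_proj S u) t) (mul_sketch_proj t) t_orth scale0r subr0.
rewrite -mulmxA !mulmxDr [X in _ <-> X = 0]addrC.
by split=> [->|/eqP]; [rewrite addNr | rewrite addr_eq0 => /eqP].
Qed.

Lemma correction_eq_unique_solution theta :
    enorm (S *m u) = 1 -> ~~ eigenvalue A theta ->
    cdot (S *m u) (S *m (invmx (A - theta%:M) *m u)) != 0 ->
  exists t : 'cV[C]_n,
    unique (fun t' => sketch_orth S t' u /\ correction_eq S A theta u t') t
    /\ u + t = (cdot (S *m u) (S *m (invmx (A - theta%:M) *m u)))^-1
               *: (invmx (A - theta%:M) *m u).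
Proof.
move=> hu /eigenvalueN_unitmx uB; set B := A - theta%:M in uB *.
set w := invmx B *m u => w_neq0; set alpha := (cdot _ _)^-1.
have puu : cdot (S *m u) (S *m u) = 1 by rewrite -enorm_sqr hu expr1n.
have utE : u + (alpha *: w - u) = alpha *: w by rewrite addrC subrK.
(* The witness is forced by the required identity [u + t = alpha *: w]. *)
exists (alpha *: w - u); split=> //; split=> [|t [t_orth]].
  have t_orth : sketch_orth S (alpha *: w - u) u.
    apply/sketch_orthE; rewrite -scaleN1r mulmxDr -!scalemxAr.
    by rewrite cdotDr !cdotZr puu mulVf // mulr1 subrr.
  split=> //; apply/correction_eqE => //.
  (* [B] sends [alpha *: w] to [alpha *: u], which [Pi] kills because [p u = 1]. *)
  rewrite utE -scalemxAr mulKVmx // -scalemxAr mul_sketch_proj puu.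
  by rewrite scale1r subrr scaler0.
(* Uniqueness: [Pi] vanishes at [B (u + t)], so this vector is [c *: u] with [c] its own value under
   [p]; applying [B^-1] gives [u + t = c *: w]. *)
move=> /(correction_eqE _ _ t_orth) /eqP; rewrite mul_sketch_proj subr_eq0 => /eqP.
set c := cdot _ _ => But; have ut : u + t = c *: w.
  by rewrite -(mulKmx uB (u + t)) But -scalemxAr.
have : cdot (S *m u) (S *m (u + t)) = 1.
  by rewrite mulmxDr cdotDr puu ((sketch_orthE t).1 t_orth) addr0.
rewrite ut -scalemxAr cdotZr => cw.
(* Both [c] and [alpha] are inverse to the nonzero scalar [p w]. *)
have -> : alpha = c by apply: (mulIf w_neq0); rewrite cw mulVf.
by rewrite -ut addrC addKr.
Qed.

End CorrectionEquation.

Theorem theorem3p1 (R : realType) (n s : nat)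
    (A : 'M[R[i]]_n) (S : 'M[R[i]]_(s, n)) (u : 'cV[R[i]]_n)
    (hu : enorm (S *m u) = 1) :
  (forall theta : R[i],
     ~~ eigenvalue A theta ->
     cdot (S *m u) (S *m (invmx (A - theta%:M) *m u)) != 0 ->
     exists t : 'cV[R[i]]_n,
       unique (fun t' => sketch_orth S t' u /\ correction_eq S A theta u t') t
       /\ u + t = (cdot (S *m u) (S *m (invmx (A - theta%:M) *m u)))^-1
                  *: (invmx (A - theta%:M) *m u))
  /\
  (let theta := sketch_rayleigh S A u in
     ~~ eigenvalue A theta ->
     cdot (S *m u) (S *m (invmx (A - theta%:M) *m u)) != 0 ->
     exists t : 'cV[R[i]]_n,
       unique (fun t' => sketch_orth S t' u /\ correction_eq S A theta u t') t
       /\ u + t = (cdot (S *m u) (S *m (invmx (A - theta%:M) *m u)))^-1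
                  *: (invmx (A - theta%:M) *m u)).
Proof.
(* The sketched Rayleigh quotient is one admissible value of the shift. *)
by split=> [theta|theta]; apply: correction_eq_unique_solution.
Qed.
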